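(* Let $G$ be a finite cyclic group of order $n\ge 2$ with generator $\gamma$, and let $D:G\times G\to G$ be the bivariate Diffie-Hellman mapping $D(\gamma^a,\gamma^b)=\gamma^{ab}$, $a,b=0,\ldots,n-1$. Then the only index pair of $D$ is $(n,n)$.
   Context: For a positive divisor $\ell$ of $n$, let $C_{\ell,0}=\{\gamma^{j\ell}: j=0,1,\ldots,n/\ell-1\}$ and $C_{\ell,i}=\gamma^i C_{\ell,0}$ for $i=0,1,\ldots,\ell-1$. For positive divisors $\ell_1,\ell_2$ of $n$, a pair $(\ell_1,\ell_2)$ is called an index pair of a mapping $f:G\times G\to G$ if there exist positive integers $r_1,r_2$ and elements $a_{k_1,k_2}\in G$ ($0\le k_1\le \ell_1-1$, $0\le k_2\le \ell_2-1$) such that $f(x,y)=a_{k_1,k_2}x^{r_1}y^{r_2}$ whenever $(x,y)\in C_{\ell_1,k_1}\times C_{\ell_2,k_2}$. *)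

(* Defs.v *)
From mathcomp Require Import all_boot all_order all_fingroup all_solvable.

Set Implicit Arguments.
Unset Strict Implicit.
Unset Printing Implicit Defensive.

Local Open Scope group_scope.

Section IndexPairs.

Variable gT : finGroupType.
Implicit Types (G : {group gT}) (gamma : gT) (f : gT * gT -> gT).

(* [n] stands for the order of the group, i.e. of [gamma]. *)
Definition cyclo0 (n : nat) gamma (l : nat) : {set gT} :=
  [set gamma ^+ (j * l) | j : 'I_(n %/ l)].

Definition cyclo (n : nat) gamma (l i : nat) : {set gT} :=
  gamma ^+ i *: cyclo0 n gamma l.

(* A mapping G x G -> G is a function on the ambient type, of which only the
   values on G x G are ever considered. The exponents r1, r2 do not depend on
   the cosets; only the coefficient [a k1 k2] does. *)
Definition index_pair G gamma f (l : nat * nat) : Prop :=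
  [/\ 0 < l.1 /\ l.1 %| #|G|,
      0 < l.2 /\ l.2 %| #|G| &
      exists (r1 r2 : nat) (a : 'I_l.1 -> 'I_l.2 -> gT),
        [/\ 0 < r1, 0 < r2,
            forall (k1 : 'I_l.1) (k2 : 'I_l.2), a k1 k2 \in G &
            forall (k1 : 'I_l.1) (k2 : 'I_l.2) x y,
              x \in cyclo #|G| gamma l.1 k1 -> y \in cyclo #|G| gamma l.2 k2 ->
              f (x, y) = a k1 k2 * x ^+ r1 * y ^+ r2]].

Definition is_DH_mapping (n : nat) gamma (D : gT * gT -> gT) : Prop :=
  forall a b : nat, a < n -> b < n ->
    D (gamma ^+ a, gamma ^+ b) = gamma ^+ (a * b).

End IndexPairs.

(* Main.v *)
(** If [gamma ^+ a] and [gamma ^+ a'] lie in the same coset of index [l1],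
    then [f (gamma ^+ a', y) = gamma ^+ ((a' - a) * r1) * f (gamma ^+ a, y)]
    for every [y], with a factor independent of [y].  If [l1 < n], take [a = 0]
    and [a' = l1]: for [f = D] the ratio is [gamma ^+ (l1 * b)] at
    [y = gamma ^+ b], so comparing [b = 0] and [b = 1] gives
    [gamma ^+ l1 = 1], which contradicts [0 < l1 < n]. *)
Require Import Defs.
From mathcomp Require Import all_boot all_fingroup all_solvable.

Set Implicit Arguments.
Unset Strict Implicit.
Unset Printing Implicit Defensive.

Local Open Scope group_scope.

Section IndexPairTheory.

Variables (gT : finGroupType) (G : {group gT}) (gamma : gT).
Implicit Types (f D : gT * gT -> gT) (n l b : nat).

(** Euclidean division of [b] by [l]: the remainder selects the coset, and [l %| n] keeps the
    quotient below [n %/ l]. *)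
Lemma expg_mem_cyclo n l b :
  l %| n -> b < n -> gamma ^+ b \in cyclo n gamma l (b %% l).
Proof.
move=> dvd_ln ltbn.
have l_gt0 : 0 < l by apply: dvdn_gt0 dvd_ln; apply: leq_ltn_trans ltbn.
have ltj : b %/ l < n %/ l by rewrite ltn_divLR // divnK.
rewrite {1}(divn_eq b l) addnC expgD mem_lcoset mulKg.
by apply/imsetP; exists (Ordinal ltj).
Qed.

Lemma cyclo_full n i : 0 < n -> cyclo n gamma n i = [set gamma ^+ i].
Proof.
move=> n_gt0; rewrite /cyclo /cyclo0 divnn n_gt0.
apply/setP=> x; rewrite mem_lcoset inE; apply/imsetP/eqP => [[j _]|->].
  by rewrite ord1 mul0n => /(canRL (mulKVg _)) ->; rewrite mulg1.
by exists ord0; rewrite // mul0n mulVg.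
Qed.

Lemma sub_cyclo n l i x :
  generator G gamma -> x \in cyclo n gamma l i -> x \in G.
Proof.
move=> genG; rewrite mem_lcoset => /imsetP[j _ /(canRL (mulKVg _)) ->].
by rewrite (eqP genG) groupM ?mem_cycle.
Qed.

(** Transfers the bound on the first index to the second, since [D] is symmetric; the powers of [x]
    and [y] trade places because a cyclic group is abelian. *)
Lemma index_pair_swap f l1 l2 :
  generator G gamma -> index_pair G gamma f (l1, l2) ->
  index_pair G gamma (fun p => f (p.2, p.1)) (l2, l1).
Proof.
move=> genG [hl1 hl2 [r1 [r2 [a [r1_gt0 r2_gt0 aG fE]]]]].
have cGG : abelian G by rewrite (eqP genG) cycle_abelian.
split=> //; exists r2, r1, (fun k2 k1 => a k1 k2); split=> // k2 k1 x y Cx Cy /=.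
rewrite (fE _ _ _ _ Cy Cx) -!mulgA; congr (_ * _).
by apply: (centsP cGG); apply: groupX; apply: sub_cyclo genG _; eassumption.
Qed.

Lemma is_DH_mapping_swap n D :
  is_DH_mapping n gamma D -> is_DH_mapping n gamma (fun p => D (p.2, p.1)).
Proof. by move=> DE a b lt_an lt_bn; rewrite /= DE // mulnC. Qed.

Lemma DH_index_left D l1 l2 :
  1 < #|G| -> generator G gamma -> is_DH_mapping #|G| gamma D ->
  index_pair G gamma D (l1, l2) -> l1 = #|G|.
Proof.
move=> n_gt1 genG DE [[/= l1_gt0 dvd1] [/= l2_gt0 dvd2]].
move=> [r1 [r2 [a [_ _ aG fE]]]].
have n_gt0 := ltnW n_gt1.
have cGG : abelian G by rewrite (eqP genG) cycle_abelian.
have Ggamma : gamma \in G by rewrite (eqP genG) cycle_id.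
have [//|ne_l1n] := eqVneq l1 #|G|.
have lt_l1n : l1 < #|G| by rewrite ltn_neqAle ne_l1n dvdn_leq.
have ratio b : b < #|G| -> gamma ^+ (l1 * b) = gamma ^+ (l1 * r1).
  move=> lt_bn; pose k1 := Ordinal l1_gt0; pose k2 := Ordinal (ltn_pmod b l2_gt0).
  have C0 : gamma ^+ 0 \in cyclo #|G| gamma l1 k1.
    by have := expg_mem_cyclo dvd1 n_gt0; rewrite mod0n.
  have C1 : gamma ^+ l1 \in cyclo #|G| gamma l1 k1.
    by have := expg_mem_cyclo dvd1 lt_l1n; rewrite modnn.
  have Cb : gamma ^+ b \in cyclo #|G| gamma l2 k2 by exact: expg_mem_cyclo.
  (* At [x = 1] the value of [D] is [1], so [a k1 k2] cancels the power of [y]; at [x = gamma ^+ l1]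
     only [gamma ^+ (l1 * r1)] survives. *)
  have := fE _ _ _ _ C0 Cb; rewrite DE // mul0n expg0 expg1n mulg1 => D0.
  rewrite -DE // (fE _ _ _ _ C1 Cb) -expgM.
  have -> : a k1 k2 * gamma ^+ (l1 * r1) = gamma ^+ (l1 * r1) * a k1 k2.
    by apply: (centsP cGG); rewrite ?groupX.
  by rewrite -mulgA -D0 mulg1.
have : gamma ^+ l1 == 1 by rewrite -(muln1 l1) ratio // -(ratio 0) // muln0.
rewrite -order_dvdn orderE -(eqP genG) => /(dvdn_leq l1_gt0).
by rewrite leqNgt lt_l1n.
Qed.

(** Cosets of index [#|G|] are singletons, so the coefficients can absorb any values of [D]. *)
Lemma DH_index_pair_full D :
  generator G gamma -> is_DH_mapping #|G| gamma D ->
  index_pair G gamma D (#|G|, #|G|).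
Proof.
move=> genG DE; have n_gt0 := cardG_gt0 G.
have Ggamma : gamma \in G by rewrite (eqP genG) cycle_id.
split=> //; exists 1%N, 1%N.
(* The value of [D] with [y], then [x], divided out on the right, the order in which multiplying by
   [x * y] cancels directly. *)
exists (fun k1 k2 => gamma ^+ (k1 * k2) * (gamma ^+ k2)^-1 * (gamma ^+ k1)^-1).
split=> // [k1 k2 | k1 k2 x y]; first by rewrite !groupM ?groupV ?groupX.
rewrite !cyclo_full // => /set1P-> /set1P->.
by rewrite DE // !expg1 !mulgKV.
Qed.

End IndexPairTheory.

Unset Implicit Arguments.
Local Close Scope group_scope.

Theorem theorem3 (gT : finGroupType) (G : {group gT}) (n : nat) (gamma : gT)
    (D : gT * gT -> gT)
    (hcard : #|G| = n) (hn : 2 <= n) (hgen : generator G gamma)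
    (hD : is_DH_mapping n gamma D) :
  forall l : nat * nat, index_pair G gamma D l <-> l = (n, n).
Proof.
subst n => -[l1 l2]; split=> [Dl | ->]; last exact: DH_index_pair_full.
congr (_, _); first exact: DH_index_left Dl.
exact: DH_index_left (is_DH_mapping_swap hD) (index_pair_swap hgen Dl).
Qed.
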